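(* Let $R$ be a unital commutative associative ring. Let $D$ be an associative $R$-algebra with a scalar involution $\overline{\phantom{x}}$, let $F$ be a locally free right $D$-module of constant finite rank, let $h:F\times F\to D$ be a (perhaps degenerate) hermitian form, and let $\times$ be a cross product on $F$ (viewed as an $R$-module). Let $A=(D,F,h,\times)$. Then $A$ is a quadratic $R$-algebra with scalar involution $$\sigma_A:A\to A,\qquad \sigma_A((\alpha,u))=(\overline{\alpha},-u),$$ and norm $n_A:A\to R$, $x\mapsto x\sigma_A(x)$, where $n_A((\alpha,u))=n_D(\alpha)+h(u,u)$. Moreover, if $n_A$ is isotropic (e.g. if $h$ is isotropic), then $A$ has zero divisors.
   Context: An ''$R$-algebra'' is a unital nonassociative algebra which is faithfully projective as an $R$-module. An involution on an $R$-algebra is an anti-automorphism of period 2; an involution $\sigma$ on $A$ is scalar if $\sigma(x)x\in R1$ for all $x\in A$. For a scalar involution, $n_A(x)=\sigma(x)x$ and $t_A(x)=\sigma(x)+x$ are a quadratic, resp. linear, form on $A$; $n_D$ denotes the form $n_D(\alpha)=\overline{\alpha}\alpha$ on $D$. An algebra $A$ is quadratic if there is a quadratic form $n:A\to R$ (its norm) with $n(1_A)=1$ and $x^2-n(1_A,x)x+n(x)1_A=0$ for all $x\in A$, where $n(x,y)=n(x+y)-n(x)-n(y)$. A sesquilinear form $h:F\times F\to D$ is a biadditive map with $h(ua,vb)=\overline{a}\,h(u,v)\,b$ for all $a,b\in D$, $u,v\in F$; it is hermitian if $h(u,v)=\overline{h(v,u)}$ for all $u,v\in F$. A cross product on $F$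 is an alternating $R$-bilinear map $\times:F\times F\to F$ (only $R$-bilinear, no compatibility with the $D$-module structure is required). Given a sesquilinear form $h$ and a cross product $\times$ on $F$, $(D,F,h,\times)$ denotes the unital $R$-algebra $D\oplus F$ with multiplication $$(\alpha,u)(\beta,v)=(\alpha\beta-h(v,u),\; v\alpha+u\overline{\beta}+v\times u)\qquad(\alpha,\beta\in D,\ u,v\in F).$$ A form $q$ (resp. $h$) is isotropic if there is $x\neq0$ with $q(x)=0$ (resp. $u\ne 0$ with $h(u,u)=0$). $A$ has zero divisors if there are nonzero $x,y\in A$ with $xy=0$.
   Formalization: The formal theorem adds the hypothesis h(u,u) ∈ R1 for all u in F; without it the claim fails (R = F_2, D = M_2(F_2) with adjugate involution, F = D, h(u,v) = ū E_12 v, × = 0), and the stated formula for n_A forces it. *)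

(* Defs.v *)
From HB Require Import structures.
From mathcomp Require Import all_boot all_algebra.

Set Implicit Arguments.
Unset Strict Implicit.
Unset Printing Implicit Defensive.

Import GRing.Theory.
Local Open Scope ring_scope.

Definition surjective (T U : Type) (f : T -> U) : Prop :=
  forall y, exists x, f x = y.

Section FaithfullyProjective.
Variables (R : comNzRingType) (M : lmodType R).

Definition finitely_generated : Prop :=
  exists (n : nat) (e : 'I_n -> M),
    forall x, exists c : 'I_n -> R, x = \sum_i c i *: e i.

Definition projective : Prop :=
  forall (U V : lmodType R) (p : {linear U -> V}) (g : {linear M -> V}),
    surjective p -> exists s : {linear M -> U}, forall x, p (s x) = g x.

Definition faithful : Prop :=
  forall r : R, (forall x : M, r *: x = 0) -> r = 0.

Definition faithfully_projective : Prop :=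
  [/\ finitely_generated, projective & faithful].

End FaithfullyProjective.

(* Nonassociative algebras are not in the library: the multiplication and the
   unit are explicit operations on an R-module A. *)
Section NonassociativeAlgebra.
Variables (R : comNzRingType) (A : lmodType R) (mul : A -> A -> A) (one : A).

Definition is_algebra : Prop :=
  [/\ forall x, linear (mul x),
      forall y, linear (mul^~ y),
      forall x, mul one x = x /\ mul x one = x
    & faithfully_projective A].

Definition is_involution (s : A -> A) : Prop :=
  [/\ linear s,
      forall x y, s (mul x y) = mul (s y) (s x)
    & forall x, s (s x) = x].

Definition is_scalar_involution (s : A -> A) : Prop :=
  is_involution s /\ forall x, exists c : R, mul (s x) x = c *: one.

Definition polar (q : A -> R) (x y : A) : R := q (x + y) - q x - q y.

Definition quadratic_form (q : A -> R) : Prop :=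
  [/\ forall (c : R) x, q (c *: x) = c ^+ 2 * q x,
      forall x, scalar (polar q x)
    & forall y, scalar ((polar q)^~ y)].

Definition is_quadratic_with_norm (q : A -> R) : Prop :=
  [/\ quadratic_form q,
      q one = 1
    & forall x, mul x x - polar q one x *: x + q x *: one = 0].

Definition isotropic (q : A -> R) : Prop := exists x, x <> 0 /\ q x = 0.

Definition has_zero_divisors : Prop :=
  exists x y, [/\ x <> 0, y <> 0 & mul x y = 0].

End NonassociativeAlgebra.

(* A right S-module is a left module over the converse ring S^c. *)
Definition ract (S : pzRingType) (M : lmodType S^c) (u : M) (a : S) : M :=
  (a : S^c) *: u.

Definition free_of_rank (S : pzRingType) (M : lmodType S^c) (n : nat) : Prop :=
  exists e : 'I_n -> M, forall w,
    exists! c : {ffun 'I_n -> S}, w = \sum_i ract (e i) (c i).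

(* A localization is given as a target together with a canonical map satisfying
   the three conditions that characterize it up to unique isomorphism: the
   element f becomes invertible, every element of the target is a fraction with
   denominator a power of f, and the kernel is the f-power torsion. *)
Section LocallyFree.
Variables (R : comNzRingType) (D : algType R).

Definition is_ring_localization (f : R) (D' : pzRingType)
    (lD : {rmorphism D -> D'}) : Prop :=
  [/\ exists s, s * lD f%:A = 1 /\ lD f%:A * s = 1,
      forall y, exists k a, y * lD (f ^+ k)%:A = lD a
    & forall a, lD a = 0 -> exists k, a * (f ^+ k)%:A = 0].

(* f acts invertibly on the D'-module F', since it is a unit of D'. *)
Definition is_module_localization (f : R) (D' : pzRingType)
    (lD : {rmorphism D -> D'}) (F : lmodType D^c) (F' : lmodType D'^c)
    (lF : {additive F -> F'}) : Prop :=
  [/\ forall u a, lF (ract u a) = ract (lF u) (lD a),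
      forall w, exists k u, ract w (lD (f ^+ k)%:A) = lF u
    & forall u, lF u = 0 -> exists k, ract u (f ^+ k)%:A = 0].

(* Locally free for the Zariski topology of Spec R: there are f_1, ..., f_m
   generating the unit ideal such that F[1/f_i] is a free right D[1/f_i]-module
   with a basis of n elements, the same n for all i. *)
Definition locally_free_of_rank (F : lmodType D^c) (n : nat) : Prop :=
  exists (m : nat) (f : 'I_m -> R),
    (exists c : 'I_m -> R, \sum_i c i * f i = 1) /\
    forall i, exists (D' : pzRingType) (lD : {rmorphism D -> D'})
                     (F' : lmodType D'^c) (lF : {additive F -> F'}),
      [/\ is_ring_localization (f i) lD,
          is_module_localization (f i) lD lF
        & free_of_rank F' n].

End LocallyFree.

(* F viewed as an R-module: r acts as r1_D. *)
Definition restr (R : comNzRingType) (D : algType R) (F : lmodType D^c) : Type :=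
  F.

Section Restriction.
Variables (R : comNzRingType) (D : algType R) (F : lmodType D^c).

HB.instance Definition _ := GRing.Zmodule.on (restr F).

Definition restr_scale (r : R) (u : restr F) : restr F := ract (u : F) r%:A.

Fact restr_scaleA a b v :
  restr_scale a (restr_scale b v) = restr_scale (a * b) v.
Proof.
rewrite /restr_scale /ract scalerA; congr (_ *: _).
by rewrite -[LHS]/((b%:A : D) * a%:A) mulr_algl scalerA mulrC.
Qed.

Fact restr_scale1 : left_id 1 restr_scale.
Proof. by move=> v; rewrite /restr_scale /ract scale1r; exact: scale1r. Qed.

Fact restr_scaleDr : right_distributive restr_scale +%R.
Proof. by move=> a u v; exact: scalerDr. Qed.

Fact restr_scaleDl v : {morph restr_scale^~ v : a b / a + b}.
Proof. by move=> a b; rewrite /restr_scale /ract scalerDl; exact: scalerDl. Qed.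

HB.instance Definition _ := GRing.Zmodule_isLmodule.Build R (restr F)
  restr_scaleA restr_scale1 restr_scaleDr restr_scaleDl.

End Restriction.

Section CrossProductAlgebra.
Variables (R : comNzRingType) (D : algType R) (bar : D -> D).
Variables (F : lmodType D^c) (h : F -> F -> D).
Variable cross : restr F -> restr F -> restr F.

Definition is_sesquilinear : Prop :=
  [/\ forall u v w, h (u + v) w = h u w + h v w,
      forall u v w, h u (v + w) = h u v + h u w
    & forall u v a b, h (ract u a) (ract v b) = bar a * h u v * b].

Definition is_hermitian : Prop :=
  is_sesquilinear /\ forall u v, h u v = bar (h v u).

Definition h_isotropic : Prop := exists u : F, u <> 0 /\ h u u = 0.

Definition is_cross_product : Prop :=
  [/\ forall u, linear (cross u),
      forall v, linear (cross^~ v)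
    & forall u, cross u u = 0].

Definition cpa : lmodType R := (D * restr F)%type.

Definition cpa_one : cpa := (1, 0).

Definition cpa_mul (x y : cpa) : cpa :=
  let: (a, u) := x in let: (b, v) := y in
  (a * b - h v u, ract (v : F) a + ract (u : F) (bar b) + cross v u).

Definition cpa_inv (x : cpa) : cpa := let: (a, u) := x in (bar a, - u).

(* The values h(u,u) are fixed by the involution, but fixed elements of D need
   not lie in R1 when 2 is not invertible: in the 2 x 2 matrices over the field
   with two elements, with the adjugate involution, every trace-zero matrix is
   fixed.  The form D + F -> R below requires this condition. *)
Definition diagonal_in_base : Prop := forall u, exists c : R, h u u = c%:A.

Lemma hermitian_diagonal_in_base :
  is_scalar_involution (A := D) *%R 1 bar -> is_hermitian ->
  (exists c : R, c * 2%:R = 1) -> diagonal_in_base.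
Proof.
move=> [[lin_bar mul_bar barK] sc] [_ herm] [c c2] u.
have barD x y : bar (x + y) = bar x + bar y.
  by have := lin_bar 1 x y; rewrite !scale1r.
have bar1 : bar 1 = 1 by have := mul_bar (bar 1) 1; rewrite mulr1 barK mulr1.
set d := h u u; have bd : bar d = d by rewrite /d -herm.
have [c1 e1] := sc (d + 1); have [c0 e0] := sc d.
have : d *+ 2 = (c1 - c0 - 1) *: (1 : D).
  rewrite !scalerBl -e1 -e0 barD bar1 bd mulrDl mulrDr !mulr1 !mul1r scale1r.
  rewrite mulr2n -[_ + d + _]addrA [_ - d * d]addrAC subrr add0r.
  by rewrite addrA addrK.
move=> e; exists (c * (c1 - c0 - 1)).
by rewrite -scalerA -e -scaler_nat scalerA c2 scale1r.
Qed.

End CrossProductAlgebra.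

(* Main.v *)
(* The identities for A are direct computations.  The substantial point is that
   F is finitely generated and projective over R.  If F[1/f_i] has a basis over
   D[1/f_i], the numerators of these bases generate F, and the coordinate maps,
   multiplied by powers of f_i, give matrices tau_i on the free module that
   split D^J -> F up to a power of f_i.  The columns of f_i^N - tau_i generate
   the kernel of D^J -> F, so a single further power of f_i makes every tau_i
   vanish on it.  Gluing the tau_i by a partition of unity gives a dual basis of
   F over D, hence F is finitely generated projective over R because D is.
   Zero divisors come from x sigma(x) = n(x) 1. *)
From HB Require Import structures.
Require Import Defs.
From mathcomp Require Import all_boot all_algebra.

Set Implicit Arguments.
Unset Strict Implicit.
Unset Printing Implicit Defensive.

Import GRing.Theory.
Local Open Scope ring_scope.

(** * Right modules and restriction of scalars to the base ring *)

Section RightModule.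
Variables (S : pzRingType) (M : lmodType S^c).
Implicit Types (u v : M) (a b : S).

Lemma ract1 u : ract u 1 = u.
Proof. exact: scale1r. Qed.

Lemma ractA u a b : ract (ract u a) b = ract u (a * b).
Proof. by rewrite /ract scalerA. Qed.

Lemma ractDl u v a : ract (u + v) a = ract u a + ract v a.
Proof. exact: scalerDr. Qed.

Lemma ractDr u a b : ract u (a + b) = ract u a + ract u b.
Proof. exact: scalerDl. Qed.

Lemma ractNl u a : ract (- u) a = - ract u a.
Proof. exact: scalerN. Qed.

Lemma ractNr u a : ract u (- a) = - ract u a.
Proof. exact: scaleNr. Qed.

Lemma ract0l a : ract (0 : M) a = 0.
Proof. exact: scaler0. Qed.

Lemma ract0r u : ract u 0 = 0.
Proof. exact: scale0r. Qed.

Lemma ract_suml (I : finType) (u : I -> M) a :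
  ract (\sum_i u i) a = \sum_i ract (u i) a.
Proof. exact: scaler_sumr. Qed.

Lemma ract_sumr (I : finType) u (a : I -> S) :
  ract u (\sum_i a i) = \sum_i ract u (a i).
Proof. exact: scaler_suml. Qed.

End RightModule.

Section Restr.
Variables (R : comNzRingType) (D : algType R) (F : lmodType D^c).
Implicit Types (r : R) (a : D) (u v : F).

Lemma restrZE r u : r *: (u : restr F) = ract u r%:A.
Proof. by []. Qed.

Lemma ractZr r u a : ract u (r *: a) = r *: (ract u a : restr F).
Proof. by rewrite restrZE ractA mulr_algr. Qed.

Lemma ractZl r u a : ract (r *: (u : restr F) : F) a = r *: (ract u a : restr F).
Proof. by rewrite !restrZE !ractA mulr_algl mulr_algr. Qed.

Lemma ract_linearl a : linear (fun u : restr F => ract (u : F) a : restr F).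
Proof. by move=> r u v; rewrite ractDl ractZl. Qed.

Lemma ract_linearr u : linear (fun a => ract u a : restr F).
Proof. by move=> r a b; rewrite ractDr ractZr. Qed.

End Restr.

(** * Clearing denominators and gluing local bases into a dual basis *)

Lemma uniform_exponent (I : finType) (P : I -> nat -> Prop) :
  (forall i k l, (k <= l)%N -> P i k -> P i l) ->
  (forall i, exists k, P i k) -> exists k, forall i, P i k.
Proof.
move=> mono /fin_all_exists[k Pk]; exists (\max_i k i) => i.
by apply: mono (Pk i); apply: leq_bigmax.
Qed.

Lemma scale_exp_mono (R : comNzRingType) (M : lmodType R) (f : R) (x : M) k l :
  (k <= l)%N -> f ^+ k *: x = 0 -> f ^+ l *: x = 0.
Proof. by move=> /subnK <- e; rewrite exprD -scalerA e scaler0. Qed.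

(** The generators are traded for their powers one index at a time: [g s] has the powers exactly at
    the indices in [s]. The result is a partition of unity for identities that hold only up to
    powers of the [f i]. *)
Lemma unit_ideal_exp (R : comNzRingType) (I : finType) (f : I -> R) :
  (exists c : I -> R, \sum_i c i * f i = 1) ->
  forall k : I -> nat, exists d : I -> R, \sum_i d i * f i ^+ k i = 1.
Proof.
move=> hf k; pose g (s : seq I) i := if i \in s then f i ^+ k i else f i.
suff: forall s, exists d : I -> R, \sum_i d i * g s i = 1.
  case/(_ (enum I)) => d e; exists d; rewrite -[RHS]e.
  by apply: eq_bigr => i _; rewrite /g mem_enum.
elim=> [|x s [d e]]; first by case: hf => c e; exists c.
have [xs|xs] := boolP (x \in s).
  exists d; rewrite -[RHS]e; apply: eq_bigr => i _; rewrite /g inE.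
  by case: eqP => [->|]; rewrite ?xs.
(* With r the sum of the other terms, 1 - (d x * f x)^k = 1 - (1 - r)^k is a
   multiple of r. *)
move: e; rewrite (bigD1 x) //= /g (negPf xs); set r := bigop _ _ _ => e.
have dxE : d x * f x = 1 - r by rewrite -e addrK.
have rE : 1 - d x * f x = r by rewrite dxE opprB addrCA subrr addr0.
have := subrXX 1 (d x * f x) (k x).
rewrite expr1n rE; set q := bigop _ _ _ => e1.
exists (fun i => if i == x then d x ^+ k x else q * d i).
rewrite (bigD1 x) //= eqxx mem_head -exprMn -[RHS](subrK ((d x * f x) ^+ k x)).
rewrite e1 [RHS]addrC /r mulr_suml; congr (_ + _).
apply: eq_bigr => i /negPf nix; rewrite nix inE nix /=.
by rewrite -mulrA mulrC.
Qed.

(* A basis after inverting f, expressed without the localization. *)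
Definition basis_up_to_power (R : comNzRingType) (D : algType R)
    (F : lmodType D^c) (f : R) (J : finType) (e : J -> F) : Prop :=
  (forall u : restr F, exists k (c : J -> D),
      f ^+ k *: u = \sum_j ract (e j) (c j)) /\
  (forall c : J -> D, \sum_j ract (e j) (c j) = 0 ->
      exists k, forall j, f ^+ k *: c j = 0).

(** The vectors of [e] are numerators of a basis of [F']. Coordinates in [F'] lift to [F] once
    denominators are cleared, up to an element killed by a power of [f]. *)
Lemma free_localization_basis (R : comNzRingType) (D : algType R)
    (F : lmodType D^c) (f : R) (n : nat) (D' : pzRingType)
    (lD : {rmorphism D -> D'}) (F' : lmodType D'^c) (lF : {additive F -> F'}) :
  is_ring_localization f lD -> is_module_localization f lD lF ->
  free_of_rank F' n ->
  exists e : 'I_n -> F, basis_up_to_power f e.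
Proof.
move=> [[s [sl sr]] fracD kerD] [lFM fracF kerF] [e' he'].
have powf k : ((f ^+ k)%:A : D) = f%:A ^+ k by rewrite exprZn expr1n.
have invr k : lD (f ^+ k)%:A * s ^+ k = 1.
  rewrite powf rmorphXn -exprMn_comm ?sr ?expr1n //.
  by rewrite /GRing.comm sl sr.
have invl k : s ^+ k * lD (f ^+ k)%:A = 1.
  rewrite powf rmorphXn -exprMn_comm ?sl ?expr1n //.
  by rewrite /GRing.comm sl sr.
have free' (b : 'I_n -> D') : \sum_j ract (e' j) (b j) = 0 -> forall j, b j = 0.
  move=> b0 j; have [c0 [_ uniq]] := he' 0.
  have c0b : c0 = [ffun j => b j].
    apply: (uniq [ffun j => b j]).
      by rewrite -[LHS]b0; apply: eq_bigr => i _; rewrite ffunE.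
  have c00 : c0 = [ffun => 0].
    by apply: (uniq [ffun => 0]); rewrite big1 // => i _; rewrite ffunE ract0r.
  by move/ffunP/(_ j): c00; rewrite c0b !ffunE.
have [k0 /fin_all_exists[e ke]] : exists k0 : 'I_n -> nat, forall j,
    exists u, ract (e' j) (lD (f ^+ k0 j)%:A) = lF u.
  apply: (fin_all_exists (P := fun j k =>
    exists u, ract (e' j) (lD (f ^+ k)%:A) = lF u)) => j.
  by have [k [u]] := fracF (e' j); exists k, u.
exists e; split=> [u|c].
- have [c' [uc' _]] := he' (lF u).
  (* [lF (e j)] is [e' j] times [f ^+ k0 j], so coordinates on the [lF (e j)] carry the inverse
     power [s ^+ k0 j]. *)
  pose b j := s ^+ k0 j * c' j.
  have lFu : lF u = \sum_j ract (lF (e j)) (b j).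
    rewrite uc'; apply: eq_bigr => j _.
    by rewrite -ke ractA mulrA invr mul1r.
  have [K /fin_all_exists[a ha]] : exists K, forall j,
      exists a, b j * lD (f ^+ K)%:A = lD a.
    apply: uniform_exponent => [j k l /subnK <- [a ha]|j]; last exact: fracD.
    exists (a * (f ^+ (l - k))%:A); rewrite rmorphM -ha -mulrA -rmorphM.
    by rewrite mulr_algl scalerA -exprD addnC.
  (* [d] vanishes in [F'], hence is killed by some power [f ^+ l] in [F]. *)
  pose d := ract u (f ^+ K)%:A - \sum_j ract (e j) (a j).
  have [|l hl] := kerF d.
    rewrite raddfB raddf_sum lFM lFu ract_suml -sumrB big1 // => j _.
    by rewrite lFM ractA ha subrr.
  exists (l + K)%N, (fun j => f ^+ l *: a j).
  rewrite exprD -scalerA.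
  have : f ^+ l *: (d : restr F) = 0 by exact: hl.
  rewrite scalerBr => /eqP; rewrite subr_eq0 => /eqP ->.
  by rewrite scaler_sumr; apply: eq_bigr => j _; rewrite ractZr.
- move=> e0; apply: uniform_exponent => [j k l|j]; first exact: scale_exp_mono.
  suff /kerD[k hk] : lD (c j) = 0 by exists k; rewrite -mulr_algr.
  (* In [F'] the relation has coefficients [lD (c j)] scaled by [f ^+ k0 j]; freeness makes them 0,
     and the scaling factor is a unit. *)
  have := free' (fun j => lD (f ^+ k0 j)%:A * lD (c j)).
  have -> : \sum_j ract (e' j) (lD (f ^+ k0 j)%:A * lD (c j)) = 0.
    rewrite -[RHS](raddf0 lF) -e0 raddf_sum; apply: eq_bigr => i _.
    by rewrite lFM -ke ractA.
  move=> /(_ erefl j) h; rewrite -[LHS]mul1r -(invl (k0 j)) -mulrA h.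
  by rewrite mulr0.
Qed.

Lemma dual_basis (R : comNzRingType) (D : algType R) (F : lmodType D^c)
    (I K : finType) (f : I -> R) (e : I -> K -> F) :
  (exists c : I -> R, \sum_i c i * f i = 1) ->
  (forall i, basis_up_to_power (f i) (e i)) ->
  exists phi : I * K -> restr F -> D,
    (forall p, linear (phi p)) /\
    forall u, u = \sum_p ract (e p.1 p.2) (phi p u).
Proof.
move=> cover basis; pose g (p : I * K) := e p.1 p.2.
pose comb (z : I * K -> D) : restr F := \sum_p ract (g p) (z p).
have eq_comb z z' : z =1 z' -> comb z = comb z'.
  by move=> zz'; apply: eq_bigr => p _; rewrite zz'.
have combZ r z : comb (fun p => r *: z p) = r *: comb z.
  by rewrite /comb scaler_sumr; apply: eq_bigr => p _; rewrite ractZr.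
have combD z z' : comb (fun p => z p + z' p) = comb z + comb z'.
  by rewrite /comb -big_split; apply: eq_bigr => p _; rewrite /= ractDr.
have combB z z' : comb (fun p => z p - z' p) = comb z - comb z'.
  by rewrite /comb -sumrB; apply: eq_bigr => p _; rewrite ractDr ractNr.
have comb_sum (L : finType) (a : L -> R) (z : L -> I * K -> D) :
    comb (fun p => \sum_l a l *: z l p) = \sum_l a l *: comb (z l).
  rewrite /comb (eq_bigr _ (fun p _ => ract_sumr _ _)) exchange_big /=.
  apply: eq_bigr => l _; rewrite scaler_sumr; apply: eq_bigr => p _.
  by rewrite ractZr.
(* The finite function and the boolean equation allow [xchoose] to be applied to [gen] below. *)
have gen u : exists z : {ffun I * K -> D}, u == comb z.
  have [k /fin_all_exists[c hc]] : exists k : I -> nat, forall i,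
      exists c : K -> D, f i ^+ k i *: u = \sum_j ract (e i j) (c j).
    apply: (fin_all_exists (P := fun i k => exists c : K -> D,
      f i ^+ k *: u = \sum_j ract (e i j) (c j))) => i; exact: (basis i).1.
  have [d hd] := unit_ideal_exp cover k.
  exists [ffun p => d p.1 *: c p.1 p.2]; apply/eqP.
  rewrite -[LHS]scale1r -hd scaler_suml.
  under [RHS]eq_bigr do rewrite ffunE ractZr.
  rewrite -(pair_bigA _
    (fun i j => d i *: (ract (e i j) (c i j) : restr F))) /=.
  by apply: eq_bigr => i _; rewrite -scaler_sumr -hc scalerA.
have [N /fin_all_exists[t ht]] : exists N : I -> nat, forall i,
    exists t : I * K -> K -> D,
      forall l, f i ^+ N i *: (g l : restr F) = \sum_j ract (e i j) (t l j).
  apply: (fin_all_exists (P := fun i k => exists t : I * K -> K -> D,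
    forall l, f i ^+ k *: (g l : restr F) = \sum_j ract (e i j) (t l j))) => i.
  have [k hk] : exists k, forall l, exists c : K -> D,
      f i ^+ k *: (g l : restr F) = \sum_j ract (e i j) (c j).
    apply: uniform_exponent => [l k k' /subnK <- [c hc]|l].
      exists (fun j => f i ^+ (k' - k) *: c j).
      rewrite exprD -scalerA hc scaler_sumr.
      by apply: eq_bigr => j _; rewrite ractZr.
    exact: (basis i).1.
  by have [t ht] := fin_all_exists hk; exists k, t.
(* [T i] has the matrix [t i] in the rows of block [i] and 0 in all other rows. The map [tau i] that
   it defines on coordinates lifts multiplication by [f i ^+ N i] along [comb]. *)
pose T i l (p : I * K) := if p.1 == i then t i l p.2 else 0.
pose tau i z p := \sum_l T i l p * z l.
have sum_block i (c : K -> D) :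
    comb (fun p => if p.1 == i then c p.2 else 0) = \sum_j ract (e i j) (c j).
  rewrite /comb /g.
  rewrite -(pair_bigA _
    (fun i' j => ract (e i' j) (if i' == i then c j else 0))).
  rewrite /= (bigD1 i) //= eqxx [X in _ + X]big1 ?addr0 // => i' /negPf ->.
  by rewrite big1 // => j _; rewrite ract0r.
have combT i l : comb (T i l) = f i ^+ N i *: (g l : restr F).
  by rewrite ht; exact: (sum_block i (t i l)).
have comb_suml (L : finType) (z : L -> I * K -> D) a :
    comb (fun p => \sum_l z l p * a l) = \sum_l ract (comb (z l)) (a l).
  rewrite /comb (eq_bigr _ (fun p _ => ract_sumr _ _)) exchange_big /=.
  apply: eq_bigr => l _; rewrite ract_suml; apply: eq_bigr => p _.
  by rewrite ractA.
have comb_tau i z : comb (tau i z) = f i ^+ N i *: comb z.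
  rewrite comb_suml scaler_sumr; apply: eq_bigr => l _.
  by rewrite combT ractZl.
(* The values of [tau i] are supported on block [i], so such a value in the kernel of [comb] is a
   relation among the [e i j] alone, and its coefficients are torsion. *)
have tau_torsion i z : comb z = 0 ->
    exists k, forall p, f i ^+ k *: tau i z p = 0.
  move=> z0; have := comb_tau i z; rewrite z0 scaler0.
  pose c j := \sum_l t i l j * z l.
  have tauE : tau i z =1 fun p => if p.1 == i then c p.2 else 0.
    move=> p; rewrite /tau /T; case: eqP => // _; rewrite big1 // => l _.
    exact: mul0r.
  rewrite (eq_comb _ _ tauE) (sum_block i c) => /((basis i).2 _)[k hk].
  by exists k => p; rewrite tauE; case: eqP => // _; rewrite scaler0.
(* The columns of f_i^(N i) - tau_i are relations among the g; together they
   generate all relations. *)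
pose rho i l p := f i ^+ N i *: (p == l)%:R - T i l p.
have comb_delta l : comb (fun p => (p == l)%:R) = g l.
  rewrite /comb (bigD1 l) //= eqxx ract1 big1 ?addr0 // => p /negPf ->.
  exact: ract0r.
have comb_rho i l : comb (rho i l) = 0.
  by rewrite combB combZ comb_delta combT subrr.
have sum_rho i z p : \sum_l rho i l p * z l = f i ^+ N i *: z p - tau i z p.
  rewrite /rho; under eq_bigr do rewrite mulrBl -scalerAl.
  rewrite sumrB; congr (_ - _); rewrite -scaler_sumr; congr (_ *: _).
  rewrite (bigD1 p) //= eqxx mul1r big1 ?addr0 // => l.
  by rewrite eq_sym => /negPf ->; rewrite mul0r.
(* The columns of all the [rho i'] are finitely many relations, so one exponent serves them all. *)
have [k hk] : exists k, forall i i' l p, f i ^+ k *: tau i (rho i' l) p = 0.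
  have [k hk] : exists k, forall x : I * I * (I * K),
      forall p, f x.1.1 ^+ k *: tau x.1.1 (rho x.1.2 x.2) p = 0.
    apply: uniform_exponent => [x k k' le h p|x].
      exact: scale_exp_mono (h p).
    exact: tau_torsion.
  by exists k => i i' l p; apply: (hk (i, i', l)).
have tau_comp i i' z p : tau i (fun q => \sum_l rho i' l q * z l) p
   = \sum_l tau i (rho i' l) p * z l.
  rewrite /tau (eq_bigr _ (fun l _ => mulr_sumr _ _ _ _)) exchange_big /=.
  apply: eq_bigr => l _; rewrite mulr_suml; apply: eq_bigr => q _.
  by rewrite mulrA.
have tau_lin (L : finType) i (a : L -> R) z p :
    tau i (fun q => \sum_l a l *: z l q) p = \sum_l a l *: tau i (z l) p.
  rewrite /tau (eq_bigr _ (fun l _ => mulr_sumr _ _ _ _)) exchange_big /=.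
  apply: eq_bigr => l _; rewrite scaler_sumr; apply: eq_bigr => q _.
  by rewrite scalerAr.
have eq_tau i z z' p : z =1 z' -> tau i z p = tau i z' p.
  by move=> zz'; apply: eq_bigr => q _; rewrite zz'.
(* Here [k] no longer depends on [z]: after scaling by a power of [f i'] that kills [tau i' z],
   [sum_rho] writes [z] through the columns of [rho i'], and a partition of unity removes the
   powers. *)
have tau_kill i z p : comb z = 0 -> f i ^+ k *: tau i z p = 0.
  move=> z0; have [k' hk'] := fin_all_exists (fun i' => tau_torsion i' z z0).
  have [d hd] := unit_ideal_exp cover (fun i' => k' i' + N i')%N.
  have zE q : z q = \sum_i' (d i' * f i' ^+ k' i') *: \sum_l rho i' l q * z l.
    rewrite -[LHS]scale1r -hd scaler_suml; apply: eq_bigr => i' _.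
    rewrite sum_rho scalerBr -[X in _ = _ - X]scalerA hk' scaler0 subr0.
    by rewrite scalerA exprD mulrA.
  rewrite (eq_tau _ _ _ _ zE) tau_lin scaler_sumr big1 // => i' _.
  rewrite scalerA mulrC -scalerA tau_comp scaler_sumr big1 ?scaler0 // => l _.
  by rewrite scalerAl hk mul0r.
(* The summand [k] kills the dependence on the chosen coordinates; [N i] is the power of [f i] that
   [tau i] itself contributes under [comb]. *)
have [d hd] := unit_ideal_exp cover (fun i => k + N i)%N.
pose Z u := xchoose (gen u); have combZu u : comb (Z u) = u.
  by apply/esym/eqP; apply: (xchooseP (gen u)).
exists (fun p u => \sum_i (d i * f i ^+ k) *: tau i (Z u) p); split=> [p r u v|u].
- rewrite scaler_sumr -big_split /=; apply: eq_bigr => i _.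
  (* [w] is the failure of the choice [Z] to be linear; it is a relation, so [f i ^+ k *: tau i]
     does not see it. *)
  pose w q := Z (r *: u + v) q - (r *: Z u q + Z v q).
  have w0 : comb w = 0 by rewrite combB combD combZ !combZu subrr.
  have := tau_kill i _ p w0.
  have -> : tau i w p =
      tau i (Z (r *: u + v)) p - (r *: tau i (Z u) p + tau i (Z v) p).
    rewrite /tau scaler_sumr -big_split -sumrB; apply: eq_bigr => q _ /=.
    by rewrite mulrBr mulrDr scalerAr.
  rewrite scalerBr => /subr0_eq key; rewrite -[LHS]scalerA key scalerA scalerDr.
  by rewrite !scalerA [r * _]mulrC.
rewrite -[RHS]/(comb (fun p => \sum_i (d i * f i ^+ k) *: tau i (Z u) p)).
rewrite comb_sum -[LHS]scale1r -hd scaler_suml; apply: eq_bigr => i _.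
by rewrite comb_tau combZu scalerA exprD mulrA.
Qed.

(** * Transfer of finite generation and projectivity *)

Lemma finitely_generated_finType (R : comNzRingType) (M : lmodType R)
    (I : finType) (e : I -> M) :
  (forall x, exists c : I -> R, x = \sum_i c i *: e i) -> finitely_generated M.
Proof.
move=> gen; exists #|I|, (fun k => e (enum_val k)) => x.
have [c ->] := gen x; exists (fun k => c (enum_val k)).
by rewrite (reindex _ (onW_bij _ (@enum_val_bij I))).
Qed.

(** [projective] quantifies over bundled linear maps, while the maps constructed here are functions
    with a separate proof of linearity. *)
Lemma linear_pack (R : comNzRingType) (U V : lmodType R) (f : U -> V) :
  linear f -> exists g : {linear U -> V}, g = f :> (U -> V).
Proof.
move=> lin_f; pose fm := GRing.isLinear.Build R U V *:%R f lin_f.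
by exists (HB.pack f fm : {linear U -> V}).
Qed.

Lemma linear_fun_ops (R : comNzRingType) (U V : lmodType R) (f : U -> V) :
  linear f ->
  [/\ f 0 = 0, {morph f : x / - x}, {morph f : x y / x + y} & scalable f].
Proof.
move=> /linear_pack[g <-].
by split; [exact: linear0|exact: linearN|exact: linearD|exact: linearZZ].
Qed.

Lemma surjective_linear_lift (R : comNzRingType) (M U V : lmodType R)
    (p : {linear U -> V}) (g : M -> V) :
  projective M -> surjective p -> linear g ->
  exists2 s : M -> U, linear s & forall x, p (s x) = g x.
Proof.
move=> Mproj psurj /linear_pack[G <-].
by have [s hs] := Mproj U V p G psurj; exists s => //; apply: linearP.
Qed.

(** The [e i] and [phi i] make [M] a direct summand of a finite power of [P]: lift each composite of
    [g] with [e i] through [p], then sum the lifts along the [phi i]. *)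
Lemma projective_dual_basis (R : comNzRingType) (P M : lmodType R)
    (I : finType) (e : I -> P -> M) (phi : I -> M -> P) :
  projective P -> (forall i, linear (e i)) -> (forall i, linear (phi i)) ->
  (forall x, x = \sum_i e i (phi i x)) -> projective M.
Proof.
move=> Pproj lin_e lin_phi dual U V p g psurj.
have /fin_all_exists2[s lin_s hs] i :
    exists2 s : P -> U, linear s & forall a, p (s a) = g (e i a).
  by apply: surjective_linear_lift => // r a b; rewrite lin_e linearP.
pose S x := \sum_i s i (phi i x).
have lin_S : linear S.
  move=> r x y; rewrite /S scaler_sumr -big_split; apply: eq_bigr => i _.
  by rewrite /= lin_phi lin_s.
have [S' S'E] := linear_pack lin_S; exists S' => x.
by rewrite S'E linear_sum [x in RHS]dual linear_sum; apply: eq_bigr.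
Qed.

Lemma finitely_generated_dual_basis (R : comNzRingType) (P M : lmodType R)
    (I : finType) (e : I -> P -> M) (phi : I -> M -> P) :
  finitely_generated P -> (forall i, linear (e i)) ->
  (forall x, x = \sum_i e i (phi i x)) -> finitely_generated M.
Proof.
move=> [m [b gen]] lin_e dual.
have lin0 i : e i 0 = 0 by have [] := linear_fun_ops (lin_e i).
apply: (finitely_generated_finType
  (e := fun k : I * 'I_m => e k.1 (b k.2))) => x.
have /fin_all_exists[c hc] i := gen (phi i x).
exists (fun k => c k.1 k.2).
rewrite -(pair_bigA _ (fun i j => c i j *: e i (b j))) [LHS]dual /=.
apply: eq_bigr => i _; rewrite hc.
elim/big_rec2: _ => [|j y z _ <-]; first exact: lin0.
exact: lin_e.
Qed.

(** Each [e i] is the right action of [D] on a fixed vector, which lets finiteness and projectivity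
    over [R] pass from [D] to [F]. *)
Lemma locally_free_dual_basis (R : comNzRingType) (D : algType R)
    (F : lmodType D^c) (n : nat) :
  locally_free_of_rank F n ->
  exists (I : finType) (e : I -> D -> restr F) (phi : I -> restr F -> D),
    [/\ forall i, linear (e i), forall i, linear (phi i)
      & forall u, u = \sum_i e i (phi i u)].
Proof.
move=> [m [f [cover loc]]].
have /fin_all_exists[e basis] i :
    exists e : 'I_n -> F, basis_up_to_power (f i) e.
  have [D' [lD [F' [lF [locD locF free]]]]] := loc i.
  exact: free_localization_basis locD locF free.
have [phi [lin_phi dual]] := dual_basis cover basis.
exists ('I_m * 'I_n)%type, (fun p a => ract (e p.1 p.2) a), phi; split=> // p.
exact: ract_linearr.
Qed.

Lemma finitely_generated_pair (R : comNzRingType) (M N : lmodType R) :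
  finitely_generated M -> finitely_generated N ->
  finitely_generated (M * N)%type.
Proof.
move=> [m [b genM]] [n [c genN]].
pose e (k : 'I_m + 'I_n) : M * N :=
  match k with inl i => (b i, 0) | inr j => (0, c j) end.
apply: (finitely_generated_finType (e := e)) => -[x y].
have [a xa] := genM x; have [d yd] := genN y.
exists (fun k => match k with inl i => a i | inr j => d j end).
rewrite big_sumType /= [LHS](_ : _ = (x, 0) + (0, y)); last first.
  by congr pair; rewrite /= ?addr0 ?add0r.
have suml (I : finType) (g : I -> M) : (\sum_i g i, 0) = \sum_i (g i, 0) :> M * N.
  elim/big_rec2: _ => // i y1 y2 _ <-.
  by congr pair; rewrite /= ?addr0.
have sumr (I : finType) (g : I -> N) : (0, \sum_i g i) = \sum_i (0, g i) :> M * N.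
  elim/big_rec2: _ => // i y1 y2 _ <-.
  by congr pair; rewrite /= ?addr0.
rewrite xa yd suml sumr; congr (_ + _); apply: eq_bigr => i _;
  by congr pair; rewrite /= ?scaler0.
Qed.

Lemma projective_pair (R : comNzRingType) (M N : lmodType R) :
  projective M -> projective N -> projective (M * N)%type.
Proof.
move=> projM projN U V p g psurj.
have [|s lin_s hs] :=
  surjective_linear_lift (g := fun x => g (x, 0)) projM psurj.
  move=> r x y; rewrite -linearP; congr (g _).
  by congr pair; rewrite /= ?scaler0 ?addr0.
have [|t lin_t ht] :=
  surjective_linear_lift (g := fun y => g (0, y)) projN psurj.
  move=> r x y; rewrite -linearP; congr (g _).
  by congr pair; rewrite /= ?scaler0 ?addr0.
pose S (x : M * N) := s x.1 + t x.2.
have lin_S : linear S.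
  move=> r x y; rewrite /S lin_s lin_t scalerDr.
  by rewrite addrACA.
have [S' S'E] := linear_pack lin_S; exists S' => -[x y].
rewrite S'E /S linearD hs ht -linearD; congr (g _).
by congr pair; rewrite /= ?addr0 ?add0r.
Qed.

(** [r%:A] determines the action of [r] on [D]. Identities between scalars can then be verified
    inside [D]. *)
Lemma faithful_alg_inj (R : comNzRingType) (D : algType R) :
  faithful D -> injective (fun r : R => r%:A : D).
Proof.
move=> Dfaith r s e; apply/subr0_eq/Dfaith => x.
by rewrite -mulr_algl scalerBl e subrr mul0r.
Qed.

(** * Norm and trace of a scalar involution *)

Section ScalarInvolution.
Variables (R : comNzRingType) (D : algType R) (bar : D -> D).
Hypothesis bar_scalar : is_scalar_involution (A := D) *%R 1 bar.

Lemma bar_linear : linear bar.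
Proof. by have [[]] := bar_scalar. Qed.

Lemma barD a b : bar (a + b) = bar a + bar b.
Proof. by have [_ _ ->] := linear_fun_ops bar_linear. Qed.

Lemma barZ r a : bar (r *: a) = r *: bar a.
Proof. by have [_ _ _ ->] := linear_fun_ops bar_linear. Qed.

Lemma barN a : bar (- a) = - bar a.
Proof. by have [_ ->] := linear_fun_ops bar_linear. Qed.

Lemma barK a : bar (bar a) = a.
Proof. by have [[_ _ ->]] := bar_scalar. Qed.

Lemma barM a b : bar (a * b) = bar b * bar a.
Proof. by have [[_ -> _]] := bar_scalar. Qed.

Lemma bar1 : bar 1 = 1.
Proof. by have := barM (bar 1) 1; rewrite mulr1 barK mulr1. Qed.

Lemma bar_alg r : bar r%:A = r%:A.
Proof. by rewrite barZ bar1. Qed.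

Lemma bar_norm a : exists c : R, bar a * a = c%:A.
Proof. by have [_] := bar_scalar; apply. Qed.

(** Replacing [a] by [a + 1] increases [bar a * a] by [a + bar a + 1], and both norms are
    scalars. *)
Lemma bar_trace a : exists c : R, a + bar a = c%:A.
Proof.
have [c ec] := bar_norm (a + 1); have [d ed] := bar_norm a.
exists (c - d - 1).
rewrite !scalerBl -ec -ed scale1r barD bar1 mulrDl mulrDr mulr1 mul1r.
by rewrite -[_ + _ + (a + 1)]addrA [_ - bar a * a]addrC addKr addrA addrK addrC.
Qed.

(** By the trace, [bar a] is a scalar minus [a], and scalars are central. *)
Lemma mul_barC a : a * bar a = bar a * a.
Proof.
have [c ec] := bar_trace a.
have -> : bar a = c%:A - a by rewrite -ec addrC addKr.
by rewrite mulrBr mulrBl mulr_algl mulr_algr.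
Qed.

End ScalarInvolution.

(** * Bilinearity, involution and norm on [D] plus [F] *)

Section CrossProduct.
Variables (R : comNzRingType) (D : algType R) (bar : D -> D).
Hypothesis bar_scalar : is_scalar_involution (A := D) *%R 1 bar.
Variables (F : lmodType D^c) (h : F -> F -> D).
Hypothesis h_herm : is_hermitian bar h.
Variable cross : restr F -> restr F -> restr F.
Hypothesis cross_cp : is_cross_product cross.
Local Notation mulA := (cpa_mul bar h cross).
Local Notation oneA := (cpa_one F).
Local Notation sigmaA := (cpa_inv bar (F := F)).

Let hDl u v w : h (u + v) w = h u w + h v w.
Proof. by have [[->]] := h_herm. Qed.

Let hDr u v w : h u (v + w) = h u v + h u w.
Proof. by have [[_ ->]] := h_herm. Qed.

Let h_ract u v a b : h (ract u a) (ract v b) = bar a * h u v * b.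
Proof. by have [[_ _ ->]] := h_herm. Qed.

Lemma herm_linear_r u : linear (h u : restr F -> D).
Proof.
move=> r v w; rewrite hDr; congr (_ + _).
by rewrite -[u in LHS]ract1 h_ract (bar1 bar_scalar) mul1r mulr_algr.
Qed.

Lemma herm_linear_l v : linear (h^~ v : restr F -> D).
Proof.
move=> r u w; rewrite /= hDl; congr (_ + _).
by rewrite -[v in LHS]ract1 h_ract (bar_alg bar_scalar) mulr1 mulr_algl.
Qed.

Let h0r u : h u 0 = 0.
Proof. by have [] := linear_fun_ops (herm_linear_r u). Qed.

Let hNr u v : h u (- v) = - h u v.
Proof. by have [_ ->] := linear_fun_ops (herm_linear_r u). Qed.

Let hNl u v : h (- u) v = - h u v.
Proof. by have [_ ->] := linear_fun_ops (herm_linear_l v). Qed.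

Let h_bar u v : bar (h u v) = h v u.
Proof. by have [_ ->] := h_herm; rewrite (barK bar_scalar). Qed.

Let crossNr u v : cross u (- v) = - cross u v.
Proof. by have [lin _ _] := cross_cp; have [_ ->] := linear_fun_ops (lin u). Qed.

Let crossNl u v : cross (- u) v = - cross u v.
Proof. by have [_ lin _] := cross_cp; have [_ ->] := linear_fun_ops (lin v). Qed.

Lemma cross_anti u v : cross v u = - cross u v.
Proof.
have [linr linl alt] := cross_cp.
have [_ _ Dr _] := linear_fun_ops (linr (u + v)).
have [_ _ Dlu _] := linear_fun_ops (linl u).
have [_ _ Dlv _] := linear_fun_ops (linl v).
apply/eqP; rewrite -addr_eq0 addrC; apply/eqP.
by have := alt (u + v); rewrite Dr Dlu Dlv !alt add0r addr0 addrC.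
Qed.

Lemma cpa_mul_linear_r x : linear (mulA x : cpa F -> cpa F).
Proof.
case: x => a u r [b v] [c w]; have [_ lin _] := cross_cp.
congr pair => /=.
  rewrite mulrDr -scalerAr (herm_linear_l u) scalerBr.
  by rewrite opprD addrACA.
rewrite ract_linearl (bar_linear bar_scalar) ract_linearr lin !scalerDr.
by rewrite [X in X + _ = _]addrACA [LHS]addrACA.
Qed.

Lemma cpa_mul_linear_l y : linear (mulA^~ y : cpa F -> cpa F).
Proof.
case: y => b v r [a u] [c w]; have [lin _ _] := cross_cp.
congr pair => /=.
  rewrite mulrDl -scalerAl (herm_linear_r v) scalerBr.
  by rewrite opprD addrACA.
rewrite ract_linearl ract_linearr lin !scalerDr.
by rewrite [X in X + _ = _]addrACA [LHS]addrACA.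
Qed.

Lemma cpa_mul1 (x : cpa F) : mulA oneA x = x /\ mulA x oneA = x.
Proof.
case: x => a u; have [linr linl _] := cross_cp.
have [c0r _ _ _] := linear_fun_ops (linr u).
have [c0l _ _ _] := linear_fun_ops (linl u).
have [h0l _ _ _] := linear_fun_ops (herm_linear_l u).
split; congr pair; rewrite /= ?(bar1 bar_scalar) ?mul1r ?mulr1 ?h0l ?h0r ?subr0 //.
  by rewrite ract1 ract0l c0r !addr0.
by rewrite ract1 ract0l c0l addr0 add0r.
Qed.

(** Reversal of products rests on hermitian symmetry in the [D] component and on antisymmetry of
    [cross] in the [F] component. *)
Lemma cpa_inv_involution :
  is_involution (mulA : cpa F -> cpa F -> cpa F) sigmaA.
Proof.
split=> [r [a u] [b v]|[a u] [b v]|[a u]].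
- by congr pair; rewrite /= ?(bar_linear bar_scalar) // opprD scalerN.
- congr pair; rewrite /=.
    by rewrite barD // barN // barM // h_bar hNl hNr opprK.
  rewrite barK // !ractNl crossNl crossNr opprK !opprD -cross_anti.
  by rewrite [- ract _ _ - _]addrC.
- by congr pair; rewrite /= ?barK ?opprK.
Qed.

(** The sign on [F] turns [- h u u] into [h u u] and makes the mixed terms cancel; the last term
    dies because [cross] is alternating. *)
Lemma cpa_norm (a : D) (u : F) :
  mulA (sigmaA (a, u)) (a, u) = (bar a * a + h u u, 0) /\
  mulA (a, u) (sigmaA (a, u)) = (bar a * a + h u u, 0).
Proof.
have [_ _ alt] := cross_cp.
split; congr pair; rewrite /= ?hNr ?hNl ?opprK ?(mul_barC bar_scalar) //.
- by rewrite ractNl crossNr alt oppr0 addr0 subrr.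
- by rewrite barK // ractNl crossNl alt oppr0 addr0 addNr.
Qed.

End CrossProduct.

Theorem corollary1 (R : comNzRingType)
    (D : algType R) (bar : D -> D)
    (D_alg : is_algebra (A := D) *%R 1)
    (D_inv : is_scalar_involution (A := D) *%R 1 bar)
    (F : lmodType D^c) (n : nat) (F_free : locally_free_of_rank F n)
    (h : F -> F -> D) (h_herm : is_hermitian bar h)
    (h_diag : diagonal_in_base h)
    (cross : restr F -> restr F -> restr F)
    (cross_cp : is_cross_product cross) :
  let A : lmodType R := cpa F in
  let mulA : A -> A -> A := cpa_mul bar h cross in
  let oneA : A := cpa_one F in
  let sigmaA : A -> A := cpa_inv bar (F := F) in
  [/\ is_algebra mulA oneA,
      is_scalar_involution mulA oneA sigmaA
    & exists nA : A -> R,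
        [/\ forall x, mulA x (sigmaA x) = nA x *: oneA
                      /\ mulA (sigmaA x) x = nA x *: oneA,
            forall (a : D) (u : F), (nA (a, u))%:A = bar a * a + h u u,
            is_quadratic_with_norm mulA oneA nA,
            h_isotropic h -> isotropic nA
          & isotropic nA -> has_zero_divisors mulA]].
Proof.
move=> A mulA oneA sigmaA.
have [_ _ _ [Dfg Dproj Dfaith]] := D_alg.
have [bar0E _ _ _] := linear_fun_ops (bar_linear D_inv).
have algI := faithful_alg_inj Dfaith.
have scale_one r : r *: oneA = (r%:A, 0) by congr pair; rewrite /= scaler0.
(* [bar_norm] and [h_diag] place the two summands in [R1]; by [algI] the scalar chosen below is the
   only possible one. *)
have ex_norm (x : A) : exists r : R, r%:A == bar x.1 * x.1 + h x.2 x.2.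
  have [r er] := bar_norm D_inv x.1; have [s es] := h_diag x.2.
  by exists (r + s); rewrite er es scalerDl.
pose nA x := xchoose (ex_norm x).
have nAE x : (nA x)%:A = bar x.1 * x.1 + h x.2 x.2.
  by apply/eqP/(xchooseP (ex_norm x)).
have norm_l x : mulA (sigmaA x) x = nA x *: oneA.
  by case: x => a u; rewrite scale_one nAE;
    apply: (cpa_norm D_inv h_herm cross_cp a u).1.
have norm_r x : mulA x (sigmaA x) = nA x *: oneA.
  by case: x => a u; rewrite scale_one nAE;
    apply: (cpa_norm D_inv h_herm cross_cp a u).2.
have sigma_invol := cpa_inv_involution D_inv h_herm cross_cp.
split.
- split.
  + exact: cpa_mul_linear_r.
  + exact: cpa_mul_linear_l.
  + exact: cpa_mul1.
  have [I [e [phi [lin_e lin_phi dual]]]] := locally_free_dual_basis F_free.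
  split.
  + apply: finitely_generated_pair => //.
    exact: finitely_generated_dual_basis Dfg lin_e dual.
  + apply: projective_pair => //.
    exact: projective_dual_basis Dproj lin_e lin_phi dual.
  + move=> r r0; apply: Dfaith => a.
    by have [] := r0 (a, 0).
- by split=> // x; exists (nA x); exact: norm_l.
have [h_lin_r h_lin_l] :=
  (herm_linear_r D_inv h_herm, herm_linear_l D_inv h_herm).
have h0r u : h u 0 = 0 by have [] := linear_fun_ops (h_lin_r u).
have h0l u : h 0 u = 0 by have [] := linear_fun_ops (h_lin_l u).
have hZr r u v : h u (r *: (v : restr F)) = r *: h u v.
  by have [_ _ _ ->] := linear_fun_ops (h_lin_r u).
have hZl r u v : h (r *: (u : restr F)) v = r *: h u v.
  by have [_ _ _ ->] := linear_fun_ops (h_lin_l v).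
(* [b] is the polar form of the norm with values in [D], where linearity is visible; [algI] brings
   it back to [R]. *)
pose b (x y : A) := bar x.1 * y.1 + bar y.1 * x.1 + (h x.2 y.2 + h y.2 x.2).
have lin_b x : linear (b x).
  move=> r y z; rewrite /b /= (bar_linear D_inv).
  rewrite h_lin_r h_lin_l.
  rewrite mulrDl mulrDr -scalerAl -scalerAr !scalerDr.
  by rewrite [X in X + _ = _]addrACA [X in _ + X = _]addrACA [LHS]addrACA.
have b_sym x y : b x y = b y x.
  by rewrite /b addrC [RHS]addrC; congr (_ + _); rewrite addrC.
have polarE x y : (polar nA x y)%:A = b x y.
  have [[hDl hDr _] _] := h_herm.
  rewrite /polar !scalerBl !nAE /b /= (barD D_inv) mulrDl !mulrDr hDl !hDr.
  apply/eqP; rewrite !subr_eq; apply/eqP.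
  (* The four mixed terms come first, then the two terms of [nA y], then those of [nA x]. *)
  by rewrite !addrA [LHS](ACl (2*3*6*7*4*8*1*5)).
have polar_lin x : scalar (polar nA x).
  move=> r y z; apply: algI; rewrite polarE lin_b /= scalerDl -scalerA.
  by rewrite !polarE.
exists nA; split=> //.
- split.
  + split=> // [r x|y r x z].
      apply: algI; rewrite nAE /= (barZ D_inv) -scalerAl -scalerAr.
      by rewrite hZr hZl -!scalerDr -nAE !scalerA.
    apply: algI; rewrite /= polarE b_sym lin_b scalerDl -scalerA !polarE.
    by rewrite ![b y _]b_sym.
  + apply: algI; rewrite nAE /= (bar1 D_inv) mulr1 scale1r.
    by rewrite h0r addr0.
  move=> [a u]; have [_ _ alt] := cross_cp.
  (* The trace of [(a, u)] is that of [a], so the quadratic identity reduces in both components to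
     multiplication by [a + bar a]. *)
  have traceE : (polar nA oneA (a, u))%:A = a + bar a.
    by rewrite polarE /b /= (bar1 D_inv) mul1r mulr1 h0r h0l !addr0.
  congr pair => /=.
    rewrite nAE -[_ *: a]mulr_algl traceE mulrDl opprD /=.
    by rewrite [X in X + _]addrACA subrr add0r -opprD [h u u + _]addrC addNr.
  rewrite alt restrZE traceE ractDr scaler0 !addr0; exact: subrr.
- move=> [u [u0 hu]]; exists (0, u); split; first by case.
  by apply: algI; rewrite nAE /= mulr0 hu addr0 scale0r.
- move=> [x [x0 nx0]]; exists x, (sigmaA x); split=> //.
    (* [sigmaA x] is nonzero because [sigmaA] is its own inverse and fixes 0. *)
    move=> sx0; apply: x0; have [_ _ sK] := sigma_invol.
    by rewrite -(sK x) -/(sigmaA x) sx0; congr pair; rewrite /= ?oppr0 ?bar0E.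
  by rewrite norm_r nx0 scale0r.
Qed.
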